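(* Let $X$ be a real Banach space whose dual $X^*$ is isometrically isomorphic to $L_1(\mu)$ for some measure $\mu$ (an $L_1$-predual). If $X$ is octahedral, then $X$ is universally octahedral.
   Context: A Banach space $W$ is octahedral if for every finite dimensional subspace $E$ of $W$ and every $\varepsilon>0$ there exists $y\in W$, $\|y\|=1$, with $\|x+\lambda y\|\ge(1-\varepsilon)(\|x\|+|\lambda|)$ for all $x\in E$, $\lambda\in\mathbb R$. $X$ is universally octahedral if the space $L(Y,X)$ of bounded operators from $Y$ to $X$ with the operator norm is octahedral for every non-zero real Banach space $Y$. *)

(* Defs.v *)
From HB Require Import structures.
From mathcomp Require Import all_boot all_order all_algebra.
From mathcomp Require Import all_classical all_reals all_analysis.
Set Implicit Arguments. Unset Strict Implicit. Unset Printing Implicit Defensive.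
Import Order.TTheory GRing.Theory Num.Theory.
Import numFieldNormedType.Exports.
Local Open Scope classical_set_scope.
Local Open Scope ring_scope.

(* Linear span of a finite family s of vectors: every finite-dimensional
   subspace E of a vector space is of this form, and conversely. *)
Definition span_seq (R : realType) (V : lmodType R) (s : seq V) : set V :=
  [set x | exists c : 'I_(size s) -> R, x = \sum_(i < size s) c i *: s`_i].

(* Octahedrality of the normed space (W, N), where W is a linear subspace
   of the vector space V and N is the norm on W.  Finite-dimensional
   subspaces E of W are given as spans of finite families of elements of W. *)
Definition octahedral_in (R : realType) (V : lmodType R) (W : set V)
    (N : V -> R) : Prop :=
  forall s : seq V, (forall v, v \in s -> W v) ->
  forall eps : R, 0 < eps ->
  exists y : V, W y /\ N y = 1 /\
    forall x, span_seq s x -> forall lam : R,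
      (1 - eps) * (N x + `|lam|) <= N (x + lam *: y).

Definition octahedral (R : realType) (X : normedModType R) : Prop :=
  octahedral_in [set: X] (fun x : X => `|x|).

Definition bdd_linear (R : realType) (Y X : normedModType R) (f : Y -> X)
    : Prop :=
  (forall (a : R) (x y : Y), f (a *: x + y) = a *: f x + f y) /\
  exists M : R, forall x : Y, `|f x| <= M * `|x|.

Definition opnorm (R : realType) (Y X : normedModType R) (f : Y -> X) : R :=
  sup [set `|f x| | x in [set x : Y | `|x| <= 1]].

Definition bdd_ops (R : realType) (Y X : normedModType R) : set (Y -> X) :=
  [set f | bdd_linear f].

Definition universally_octahedral (R : realType) (X : normedModType R) : Prop :=
  forall Y : completeNormedModType R, (exists y : Y, y != 0) ->
    octahedral_in (@bdd_ops R Y X) (@opnorm R Y X).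

(* X is an L_1-predual: its dual X^* = L(X, R) (operator norm) is isometrically
   isomorphic to L_1(mu) for some measure mu.  The isomorphism is given by
   Phi, mapping each functional to a representative of its class in L_1(mu);
   it is linear modulo mu-a.e. equality, isometric, and onto L_1(mu).
   (Injectivity follows from isometry.) *)
Definition L1_predual (R : realType) (X : normedModType R) : Prop :=
  exists (d : measure_display) (T : measurableType d)
         (mu : {measure set T -> \bar R}) (Phi : (X -> R^o) -> (T -> R)),
    (forall f, bdd_linear f -> Phi f \in Lfun mu 1%E) /\
    (forall (a : R) (f g : X -> R^o), bdd_linear f -> bdd_linear g ->
       Phi (a *: f + g) = a *: Phi f + Phi g %[ae mu]) /\
    (forall f, bdd_linear f ->
       ((opnorm f)%:E = 'N[mu]_1%E [EFin \o Phi f])%E) /\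
    (forall g : T -> R, g \in Lfun mu 1%E ->
       exists f : X -> R^o, bdd_linear f /\ Phi f = g %[ae mu]).

(* Main.v *)
(** Choose finitely many operators [T_k] forming a net of the unit ball of the
    given span and unit vectors [y_k] almost norming them.  Octahedrality of [X],
    applied repeatedly to the points [T_k y_k], yields unit vectors [u_j] such that
    all signed sums [T_k y_k + sum_j +-u_j] have almost maximal norm.  Norming
    functionals [f_k] of suitable such sums almost norm [T_k y_k] and satisfy
    [|f_k + f_l|, |f_k - f_l| >= 2 - d] for [k <> l]; in [L_1] this says that they
    are almost disjoint.  By Hahn-Banach (in the Mazur-Orlicz form), almost
    disjointness provides [e_k] in [X] with [sum_k f_k(e_k)] almost maximal and all
    signed sums [sum_k +-e_k] of norm at most 1, so that [f_k(e_l)] is almost the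
    Kronecker symbol.  If [phi_k] is a norming functional of [y_k], the operator
    [S v = sum_k phi_k(v) e_k] is a contraction and
    [f_k(T_k y_k + lam S y_k)] is almost [|T_k y_k| + lam]. *)
Require Import Defs.
From mathcomp Require Import all_boot all_order all_algebra.
From mathcomp Require Import all_classical all_reals all_analysis.
From mathcomp Require Import ring lra.
Set Implicit Arguments. Unset Strict Implicit. Unset Printing Implicit Defensive.
Import Order.TTheory GRing.Theory Num.Theory.
Import numFieldNormedType.Exports.
Local Open Scope classical_set_scope.
Local Open Scope ring_scope.

(** * Linear forms and the Mazur-Orlicz theorem *)

Section LinearForms.
Variables (R : realType) (V : lmodType R).

Definition linear_form (f : V -> R) := forall a x y, f (a *: x + y) = a * f x + f y.

Variable g : V -> R.
Hypothesis lg : linear_form g.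

Lemma linear_form0 : g 0 = 0.
Proof. by have := lg 1 0 0; rewrite scaler0 addr0; lra. Qed.

Lemma linear_formZ a x : g (a *: x) = a * g x.
Proof. by rewrite -[a *: x]addr0 lg linear_form0 addr0. Qed.

Lemma linear_form_sum (I : Type) (r : seq I) (P : pred I) (u : I -> V) :
  g (\sum_(i <- r | P i) u i) = \sum_(i <- r | P i) g (u i).
Proof.
apply: (big_morph g) => [x y|]; last exact: linear_form0.
by rewrite -[x]scale1r lg scale1r mul1r.
Qed.

End LinearForms.

Section MazurOrlicz.
Variables (R : realType) (V : lmodType R).
Implicit Types (p q : V -> R) (x y v : V).

(** The converse of the second inequality follows: for [a > 0] by scaling back with [a^-1], for
    [a = 0] from [sublinear0]. *)
Definition sublinear q :=
  (forall x y, q (x + y) <= q x + q y) /\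
  (forall a x, 0 <= a -> q (a *: x) <= a * q x).

Lemma sublinear0 q : sublinear q -> q 0 = 0.
Proof.
move=> [qD qZ]; apply/eqP; rewrite eq_le; apply/andP; split.
  by have := qZ 0 0 (lexx _); rewrite scale0r mul0r.
by have := qD 0 0; rewrite addr0; lra.
Qed.

(** Candidate values can be added and scaled up to a decrease, and this survives passing to infima.
    It serves both the minorant of [sublinear_lower] and the infimum of a chain. *)
Lemma inf_sublinear (A : V -> set R) :
  (forall x, A x !=set0) -> (forall x, has_lbound (A x)) ->
  (forall x y r s, A x r -> A y s -> exists2 t, A (x + y) t & t <= r + s) ->
  (forall a x r, 0 <= a -> A x r -> exists2 t, A (a *: x) t & t <= a * r) ->
  sublinear (fun x => inf (A x)).
Proof.
move=> A0 Alb AD AZ; split=> [x y|a x a0] /=.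
  rewrite -inf_sumE; [|by split..].
  apply: lb_le_inf => [|_ [r Ar [s As <-]]].
    by have [[r Ar] [s As]] := (A0 x, A0 y); exists (r + s), r => //; exists s.
  by have [t At ts] := AD _ _ _ _ Ar As; rewrite (le_trans _ ts)// ge_inf.
have [->|a1] /= := eqVneq a 0.
  have [r Ar] := A0 x; have [t At tr] := AZ 0 x r (lexx _) Ar.
  by rewrite mul0r in tr; rewrite mul0r (le_trans _ tr)// ge_inf.
have {a1}a0 : 0 < a by rewrite lt_def a1.
rewrite mulrC -ler_pdivrMr//; apply: lb_le_inf => // r Ar.
have [t At tr] := AZ _ _ _ (ltW a0) Ar.
by rewrite ler_pdivrMr// mulrC (le_trans _ tr)// ge_inf.
Qed.

(** A convex cone of constraints [b <= f v] on an unknown linear form [f <= q]; the last clause is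
    the evident necessary condition. A ray yields a norming functional, a graph yields an
    extension. *)
Definition dominated_cone q (C : set (V * R)) :=
  [/\ C (0, 0),
      (forall v b w c, C (v, b) -> C (w, c) -> C (v + w, b + c)),
      (forall a v b, 0 <= a -> C (v, b) -> C (a *: v, a * b)) &
      (forall v b, C (v, b) -> b <= q v)].

(** The minorant is the infimum of [q (x + v) - b] over [(v, b)] in [C], bounded below by
    [- q (- x)] because [b <= q v <= q (x + v) + q (- x)]. A linear form below it satisfies every
    constraint in [C]. *)
Lemma sublinear_lower q (C : set (V * R)) : sublinear q -> dominated_cone q C ->
  exists q', [/\ sublinear q', (forall x, q' x <= q x) &
                 forall v b, C (v, b) -> q' (- v) <= - b].
Proof.
move=> sq [C0 CD CZ Cq]; have [qD qZ] := sq.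
pose A x := [set r | exists v b, C (v, b) /\ r = q (x + v) - b].
have Alb x : has_lbound (A x).
  exists (- q (- x)) => _ [v [b [/Cq Cvb ->]]].
  by have := qD (x + v) (- x); rewrite addrAC subrr add0r; lra.
have Aq x : A x (q x) by exists 0, 0; rewrite addr0 subr0.
exists (fun x => inf (A x)); split => [|x|v b Cvb].
- apply: inf_sublinear => [x||x y _ _ [v [b [Cv ->]]] [w [c [Cw ->]]]
                         |a x _ a0 [v [b [Cv ->]]]] //.
  + by exists (q x).
  + exists (q (x + y + (v + w)) - (b + c)).
      by exists (v + w), (b + c); split => //; exact: CD.
    by have := qD (x + v) (y + w); rewrite addrACA; lra.
  + exists (q (a *: x + a *: v) - a * b).
      by exists (a *: v), (a * b); split => //; exact: CZ.
    by have := qZ a (x + v) a0; rewrite scalerDr; lra.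
- exact: ge_inf.
- apply: ge_inf => //; exists v, b; split => //.
  by rewrite addNr sublinear0// sub0r.
Qed.

Lemma minimal_sublinear p : sublinear p ->
  exists q, [/\ sublinear q, (forall x, q x <= p x) &
    forall q', sublinear q' -> (forall x, q' x <= q x) -> q' = q].
Proof.
move=> sp; pose P q := sublinear q /\ forall x, q x <= p x.
pose T := {q : V -> R | P q}.
have Pp : P p by split=> // x.
(* The order is reversed, since [ZL_preorder] produces maximal elements. *)
pose ord (q q' : T) := `[< forall x, sval q' x <= sval q x >].
have [||F Ftot|[q [sq qp]] qmin] :=
    @ZL_preorder T (exist P p Pp) ord.
- by move=> q; apply/asboolP.
- move=> r s t /asboolP sr /asboolP ts; apply/asboolP => x.
  exact: le_trans (ts x) (sr x).
- have [[q0 Fq0]|] := pselect (F !=set0); last first.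
    move=> F0; exists (exist P p Pp) => s Fs.
    by case: F0; exists s.
  pose A x := [set sval q x | q in F].
  have Alb x : has_lbound (A x).
    exists (- p (- x)) => _ [[q [sq qp]] _ <-] /=.
    have := (sq.1 x (- x), qp (- x)); rewrite subrr sublinear0//.
    by case; lra.
  have sA : sublinear (fun x => inf (A x)).
    apply: inf_sublinear => // [x|x y _ _ [q Fq <-] [r Fr <-]|a x _ a0 [q Fq <-]].
    + by exists (sval q0 x), q0.
    (* The smaller of two members of the chain supplies the value at [x + y]. *)
    + have [/asboolP qr|/asboolP rq] := Ftot _ _ Fq Fr.
        exists (sval r (x + y)); first by exists r.
        by have := (svalP r).1.1 x y; have := qr x; lra.
      exists (sval q (x + y)); first by exists q.
      by have := (svalP q).1.1 x y; have := rq y; lra.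
    + by exists (sval q (a *: x)); [exists q|exact: (svalP q).1.2].
  have Ap x : inf (A x) <= p x.
    by rewrite (le_trans _ ((svalP q0).2 x))//; apply: ge_inf => //; exists q0.
  exists (exist P (fun x => inf (A x)) (conj sA Ap)) => s Fs; apply/asboolP => x /=.
  by apply: ge_inf => //; exists s.
exists q; split => // q' sq' q'q.
have q'p x : q' x <= p x := le_trans (q'q x) (qp x).
apply/funext => x; apply/le_anti; rewrite q'q /=.
have /(_ _)/asboolP/(_ x) := qmin (exist P q' (conj sq' q'p)).
by apply; apply/asboolP.
Qed.

(* A minimal sublinear functional [q] is odd: the sublinear minorant of [q] at
   [- y] given by [sublinear_lower] for the ray through [y] equals [q]. *)
Lemma dominated_linear_form p : sublinear p ->
  exists2 f, linear_form f & forall x, f x <= p x.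
Proof.
move=> /minimal_sublinear[q [sq qp qmin]]; have [qD qZ] := sq.
have qN y : q (- y) = - q y.
  have [|q' [sq' q'q q'y]] :=
      @sublinear_lower q [set u | exists2 t, 0 <= t & u = (t *: y, t * q y)] sq.
  - split=> [|v b w c [t t0 [-> ->]] [u u0 [-> ->]]|a v b a0 [t t0 [-> ->]]
            |v b [t t0 [-> ->]]].
    + by exists 0; rewrite // scale0r mul0r.
    + by exists (t + u); [exact: addr_ge0|rewrite scalerDl mulrDl].
    + by exists (a * t); [exact: mulr_ge0|rewrite scalerA mulrA].
    + have [->|tn0] := eqVneq t 0; first by rewrite scale0r mul0r sublinear0.
      have tp : 0 < t by rewrite lt_def tn0.
      have := qZ t^-1 (t *: y); rewrite scalerA mulVf// scale1r invr_ge0 t0.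
      by move=> /(_ isT); rewrite mulrC ler_pdivlMr// mulrC.
  have := q'y y (q y); rewrite (qmin _ sq' q'q) => q'Ny.
  apply/le_anti; rewrite q'Ny; last by exists 1; rewrite ?scale1r ?mul1r.
  by have := qD y (- y); rewrite subrr sublinear0//; lra.
have qaD x y : q (x + y) = q x + q y.
  apply/le_anti; rewrite qD /=.
  by have := qD (x + y) (- y); rewrite addrK qN; lra.
have qaZ a x : 0 <= a -> q (a *: x) = a * q x.
  move=> a0; apply/le_anti; rewrite qZ//=.
  by have := qZ a (- x) a0; rewrite scalerN !qN; lra.
exists q => // a x y; rewrite qaD; congr (_ + _).
have [a0|a0] := leP 0 a; first exact: qaZ.
by rewrite -[a]opprK scaleNr qN qaZ ?mulNr// oppr_ge0 ltW.
Qed.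

Theorem mazur_orlicz p C : sublinear p -> dominated_cone p C ->
  exists f, [/\ linear_form f, (forall x, f x <= p x) &
                forall v b, C (v, b) -> b <= f v].
Proof.
move=> sp dC; have [q [sq qp qC]] := sublinear_lower sp dC.
have [f lf fq] := dominated_linear_form sq; exists f; split => //.
  by move=> x; exact: le_trans (fq x) (qp x).
move=> v b /qC; have := fq (- v).
by rewrite -scaleN1r linear_formZ//; lra.
Qed.

End MazurOrlicz.

(** * Bounded operators and the operator norm *)

Section BoundedOperators.
Variables (R : realType) (Y X : normedModType R).
Implicit Types f g : Y -> X.

Lemma bdd_linear0 f : bdd_linear f -> f 0 = 0.
Proof.
move=> [lf _]; have := lf 1 0 0; rewrite !scale1r addr0 => /eqP.
by rewrite -subr_eq0 opprD addrA subrr sub0r oppr_eq0 => /eqP.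
Qed.

Lemma bdd_linearZ f a x : bdd_linear f -> f (a *: x) = a *: f x.
Proof. by move=> bf; rewrite -[a *: x]addr0 bf.1 bdd_linear0// addr0. Qed.

Lemma bdd_linearD f x y : bdd_linear f -> f (x + y) = f x + f y.
Proof. by move=> bf; rewrite -[x]scale1r bf.1 !scale1r. Qed.

Lemma bdd_linear_sum f (I : Type) (r : seq I) (P : pred I) (u : I -> Y) :
  bdd_linear f -> f (\sum_(i <- r | P i) u i) = \sum_(i <- r | P i) f (u i).
Proof.
move=> bf; apply: (big_morph f) => [x y|]; [exact: bdd_linearD|].
exact: bdd_linear0.
Qed.

Lemma opnorm_has_sup f : bdd_linear f ->
  has_sup [set `|f x| | x in [set x : Y | `|x| <= 1]].
Proof.
move=> [_ [M fM]]; split; first by exists `|f 0|, 0; rewrite //= normr0.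
exists `|M| => _ [x /= x1 <-]; rewrite (le_trans (fM x))//.
by rewrite (le_trans (ler_norm _))// normrM normr_id ler_piMr.
Qed.

Lemma opnorm_ge0 f : bdd_linear f -> 0 <= opnorm f.
Proof.
move=> bf; have [_ ub] := opnorm_has_sup bf.
by rewrite (le_trans (normr_ge0 (f 0)))// ub_le_sup//; exists 0; rewrite //= normr0.
Qed.

Lemma le_opnorm f x : bdd_linear f -> `|f x| <= opnorm f * `|x|.
Proof.
move=> bf; have [->|x0] := eqVneq x 0; first by rewrite bdd_linear0// !normr0 mulr0.
have nx : 0 < `|x| by rewrite normr_gt0.
rewrite -ler_pdivrMr//; have [_ ub] := opnorm_has_sup bf.
apply: ub_le_sup => //; exists (`|x|^-1 *: x).
  by rewrite /= normrZ normfV normr_id mulVf// gt_eqF.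
by rewrite bdd_linearZ// normrZ normfV normr_id mulrC.
Qed.

Lemma opnorm_le f M : (forall x, `|x| <= 1 -> `|f x| <= M) -> opnorm f <= M.
Proof.
move=> fM; apply: ge_sup => [|_ [x /= x1 <-]]; last exact: fM.
by exists `|f 0|, 0; rewrite //= normr0.
Qed.

Lemma opnorm_approx f d : bdd_linear f -> 0 < d ->
  exists2 x, `|x| <= 1 & opnorm f - d < `|f x|.
Proof.
by move=> /opnorm_has_sup hs d0; have [_ [x x1 <-] fx] := sup_adherent d0 hs; exists x.
Qed.

Lemma bdd_linear_cst0 : bdd_linear (0 : Y -> X).
Proof.
split=> [a x y|]; first by change (0 = a *: (0 : X) + 0); rewrite scaler0 addr0.
by exists 0 => x; change (`|0 : X| <= 0 * `|x|); rewrite normr0 mul0r.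
Qed.

Lemma bdd_linear_lin a f g : bdd_linear f -> bdd_linear g -> bdd_linear (a *: f + g).
Proof.
move=> bf bg; split=> [b x y|].
  rewrite !fctE bf.1 bg.1 !scalerDr !scalerA [b * a]mulrC.
  by rewrite -!addrA; congr (_ + _); rewrite addrCA.
have [[_ [M fM]] [_ [N gN]]] := (bf, bg).
exists (`|a| * M + N) => x; rewrite !fctE (le_trans (ler_normD _ _))// normrZ.
by rewrite mulrDl -mulrA lerD// ler_wpM2l.
Qed.

Lemma bdd_linear_scale a f : bdd_linear f -> bdd_linear (a *: f).
Proof. by move=> bf; rewrite -[a *: f]addr0; exact: bdd_linear_lin bdd_linear_cst0. Qed.

Lemma bdd_linear_add f g : bdd_linear f -> bdd_linear g -> bdd_linear (f + g).
Proof. by move=> bf; rewrite -[f]scale1r; exact: bdd_linear_lin. Qed.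

Lemma bdd_linear_sumf (I : Type) (r : seq I) (P : pred I) (F : I -> Y -> X) :
  (forall i, P i -> bdd_linear (F i)) -> bdd_linear (\sum_(i <- r | P i) F i).
Proof.
move=> bF; apply: (big_ind (@bdd_linear R Y X)) => //; first exact: bdd_linear_cst0.
exact: bdd_linear_add.
Qed.

Lemma opnormD f g : bdd_linear f -> bdd_linear g ->
  opnorm (f + g) <= opnorm f + opnorm g.
Proof.
move=> bf bg; apply: opnorm_le => x x1; rewrite !fctE (le_trans (ler_normD _ _))//.
by rewrite lerD// (le_trans (le_opnorm _ _))// ler_piMr// opnorm_ge0.
Qed.

Lemma opnormZ a f : bdd_linear f -> opnorm (a *: f) = `|a| * opnorm f.
Proof.
have leZ b g : bdd_linear g -> opnorm (b *: g) <= `|b| * opnorm g.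
  move=> bg; apply: opnorm_le => x x1; rewrite !fctE normrZ ler_wpM2l//.
  by rewrite (le_trans (le_opnorm _ _))// ler_piMr// opnorm_ge0.
move=> bf; apply/le_anti; rewrite leZ//=.
have [->|a0] := eqVneq a 0.
  by rewrite normr0 mul0r opnorm_ge0//; exact: bdd_linear_scale.
have := leZ a^-1 _ (bdd_linear_scale a bf).
rewrite scalerA mulVf// scale1r normfV.
by rewrite mulrC ler_pdivlMr ?normr_gt0// mulrC.
Qed.

End BoundedOperators.

(** * Norming functionals *)

Section Functionals.
Variables (R : realType) (X : normedModType R).

Lemma linear_form_bdd (f : X -> R) (M : R) : linear_form f ->
  (forall x, f x <= M * `|x|) -> @bdd_linear R X R^o f.
Proof.
move=> lf fM; split; first exact: lf.
exists M => x; rewrite ler_norml fM andbT lerNl -normrN.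
by rewrite -[X in X <= _]mulN1r -linear_formZ// scaleN1r.
Qed.

(** Mazur-Orlicz with the norm as bound and constraints along the ray through [w]. *)
Lemma norming_functional (w : X) :
  exists f : X -> R^o, [/\ bdd_linear f, (forall x, `|f x| <= `|x|) & f w = `|w|].
Proof.
have [||f [lf f1 fw]] := @mazur_orlicz R X (fun x => `|x|)
    [set u | exists2 t, 0 <= t & u = (t *: w, t * `|w|)].
- by split=> [x y|a x a0]; [exact: ler_normD|rewrite normrZ ger0_norm].
- split=> [|v b u c [t t0 [-> ->]] [s s0 [-> ->]]|a v b a0 [t t0 [-> ->]]
          |v b [t t0 [-> ->]]].
  + by exists 0; rewrite // scale0r mul0r.
  + by exists (t + s); [exact: addr_ge0|rewrite scalerDl mulrDl].
  + by exists (a * t); [exact: mulr_ge0|rewrite scalerA mulrA].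
  + by rewrite normrZ ger0_norm.
have bf : @bdd_linear R X R^o f.
  by apply: (@linear_form_bdd f 1) => // x; rewrite mul1r.
exists f; split => // [x|].
  rewrite ler_norml f1 andbT lerNl -normrN.
  suff <- : f (- x) = - f x by exact: f1.
  by rewrite -[- x]scaleN1r; exact: etrans (bdd_linearZ _ _ bf) (scaleN1r _).
by apply/le_anti; rewrite f1 fw//; exists 1; rewrite // scale1r mul1r.
Qed.

End Functionals.

(** * Integrals with finite values *)

Section HasIntegral.
Variables (d : measure_display) (T : measurableType d) (R : realType).
Variable mu : {measure set T -> \bar R}.

(** Integrability and value are kept together so that linear combinations of integrals are computed
    in the reals. *)
Definition has_integral (G : T -> R) (r : R) :=
  mu.-integrable setT (EFin \o G) /\ (\int[mu]_x (G x)%:E = r%:E)%E.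

Lemma has_integralD G H r s : has_integral G r -> has_integral H s ->
  has_integral (fun x => G x + H x) (r + s).
Proof.
move=> [iG Gr] [iH Hs]; split; first exact: (integrableD measurableT iG iH).
under eq_integral do rewrite EFinD.
by rewrite (integralD measurableT iG iH) [X in (X + _)%E]Gr [X in (_ + X)%E]Hs.
Qed.

Lemma has_integralZ a G r : has_integral G r ->
  has_integral (fun x => a * G x) (a * r).
Proof.
move=> [iG Gr]; split; first exact: (integrableZl measurableT a iG).
under eq_integral do rewrite EFinM.
by rewrite (integralZl measurableT iG) [X in (_ * X)%E]Gr.
Qed.

Lemma has_integralB G H r s : has_integral G r -> has_integral H s ->
  has_integral (fun x => G x - H x) (r - s).
Proof.
move=> hG /(has_integralZ (-1)) hH; rewrite -[- s]mulN1r.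
rewrite (_ : (fun x => _) = (fun x => G x + -1 * H x)); first exact: has_integralD.
by apply/funext => x; rewrite mulN1r.
Qed.

Lemma has_integral_sum (I : Type) (r : seq I) (P : pred I) (G : I -> T -> R)
    (c : I -> R) : (forall i, P i -> has_integral (G i) (c i)) ->
  has_integral (fun x => \sum_(i <- r | P i) G i x) (\sum_(i <- r | P i) c i).
Proof.
move=> hG; elim: r => [|i r ih].
  rewrite big_nil (_ : (fun x => _) = cst 0).
    by split; [exact: integrable0|rewrite integral0].
  by apply/funext => x; rewrite big_nil.
rewrite big_cons; case: ifPn => Pi.
  rewrite (_ : (fun x => _) = (fun x => G i x + \sum_(j <- r | P j) G j x)).
    exact: has_integralD (hG _ Pi) ih.
  by apply/funext => x; rewrite big_cons Pi.
rewrite (_ : (fun x => _) = (fun x => \sum_(j <- r | P j) G j x))//.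
by apply/funext => x; rewrite big_cons (negbTE Pi).
Qed.

Lemma has_integral_ge0 G r : has_integral G r ->
  (\forall x \ae mu, 0 <= G x) -> 0 <= r.
Proof.
move=> [iG Gr] G0; have mG := measurable_int _ iG.
(* [G] is nonnegative only almost everywhere, so it is replaced by its absolute value. *)
rewrite -lee_fin -Gr (@ae_eq_integral _ _ _ mu setT (fun x => `|(G x)%:E|)%E)//.
- exact: integral_ge0.
- exact: (measurable_int _ (integrable_abse iG)).
- by apply: filterS G0 => x Gx _; rewrite gee0_abs.
Qed.

End HasIntegral.

(** * Almost disjointness in L_1 *)

Section L1Disjointness.
Variable R : realType.

(** Each summand of the double sum is the minimum of the two absolute values. The largest entry
    [a m] is bounded by [H]; every other entry is its own minimum with [a m], hence a term of the
    double sum. *)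
Lemma sum_norm_le_max (I : finType) (a : I -> R) (H : R) :
  0 <= H -> (forall i, `|a i| <= H) ->
  \sum_i `|a i| <= H + \sum_i \sum_(k | k != i)
    (`|a i| + `|a k| - (`|a i + a k| + `|a i - a k|) / 2).
Proof.
move=> H0 aH.
have t0 x y : 0 <= `|x| + `|y| - (`|x + y| + `|x - y|) / 2 :> R.
  by have := ler_normD x y; have := ler_normB x y; lra.
have [i0 _|noI] := pickP (@predT I); last first.
  by rewrite !big_pred0 ?addr0// => i; have := noI i.
pose m := [arg max_(i > i0) `|a i|]%O.
have am i : `|a i| <= `|a m|.
  by rewrite /m; case: Order.TotalTheory.arg_maxP => // j _; apply.
rewrite (bigD1 m)//=; apply: lerD => //.
rewrite [leRHS](bigD1 m)//=; apply: ler_wpDl; first by apply: sumr_ge0 => i _.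
apply: ler_sum => i im; rewrite (bigD1 m) 1?eq_sym//=.
apply: ler_wpDr; first by apply: sumr_ge0 => k _.
have := am i.
(* [|x+y| + |x-y| = 2 max(|x|,|y|)] *)
by case: (ger0P (a i)); case: (ger0P (a m)); case: (ger0P (a i + a m));
  case: (ger0P (a i - a m)); lra.
Qed.

Variable X : normedModType R.

(** [sum_norm_le_max] is applied pointwise to the representatives [Phi (f i)], with the sum of the
    absolute values of the [Phi (h j)] as [H], and then integrated. *)
Lemma L1_predual_norm_sum (I J : finType) (f : I -> X -> R^o) (h : J -> X -> R^o)
    (c : I -> J -> R) : L1_predual X ->
  (forall i, bdd_linear (f i)) -> (forall j, bdd_linear (h j)) ->
  (forall i j, `|c i j| <= 1) -> (forall i, f i = \sum_j c i j *: h j) ->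
  \sum_i opnorm (f i) <= \sum_j opnorm (h j) + \sum_i \sum_(k | k != i)
    (opnorm (f i) + opnorm (f k) - (opnorm (f i + f k) + opnorm (f i - f k)) / 2).
Proof.
move=> [d [T [mu [Phi [PhiL [Philin [Phinorm _]]]]]]] bf bh c1 fh.
have Phi_int g : bdd_linear g -> has_integral mu (fun x => `|Phi g x|) (opnorm g).
  move=> bg; have /Lfun1_integrable iPg := PhiL _ bg; split.
    exact: (integrable_abse iPg).
  by rewrite Phinorm// Lnorm1.
have bNf i : bdd_linear (- f i) by rewrite -scaleN1r; exact: bdd_linear_scale.
have PhiD g1 g2 : bdd_linear g1 -> bdd_linear g2 ->
    \forall x \ae mu, Phi (g1 + g2) x = Phi g1 x + Phi g2 x.
  move=> b1 b2; have := Philin 1 _ _ b1 b2; apply: filterS => x /(_ Logic.I).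
  by rewrite !scale1r.
have Phi0 : \forall x \ae mu, Phi 0 x = 0.
  have := PhiD _ _ (@bdd_linear_cst0 R X R^o) (@bdd_linear_cst0 R X R^o).
  by apply: filterS => x; rewrite addr0; lra.
have PhiZ a g : bdd_linear g -> \forall x \ae mu, Phi (a *: g) x = a * Phi g x.
  move=> bg; have := Philin a _ _ bg (@bdd_linear_cst0 R X R^o).
  apply: filterS2 Phi0 => x P0 /(_ Logic.I); rewrite addr0 => ->.
  by rewrite !fctE P0 addr0.
have Phisum (r : seq J) i : \forall x \ae mu,
    Phi (\sum_(j <- r) c i j *: h j) x = \sum_(j <- r) c i j * Phi (h j) x.
  elim: r => [|j r ih].
    by rewrite big_nil; apply: filterS Phi0 => x ->; rewrite big_nil.
  have bj := bdd_linear_scale (c i j) (bh j).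
  have br : bdd_linear (\sum_(j <- r) c i j *: h j).
    by apply: bdd_linear_sumf => k _; exact: bdd_linear_scale.
  rewrite big_cons; have := PhiD _ _ bj br.
  apply: filterS3 ih (PhiZ (c i j) _ (bh j)) => x ih PZ ->.
  by rewrite big_cons ih PZ.
rewrite -subr_ge0.
apply: (@has_integral_ge0 _ _ _ mu (fun x =>
   \sum_j `|Phi (h j) x| + \sum_i \sum_(k | k != i)
    (`|Phi (f i) x| + `|Phi (f k) x|
       - (`|Phi (f i + f k) x| + `|Phi (f i - f k) x|) / 2)
   - \sum_i `|Phi (f i) x|)).
  apply: has_integralB; last by apply: has_integral_sum => i _; exact: Phi_int.
  apply: has_integralD; first by apply: has_integral_sum => j _; exact: Phi_int.
  apply: has_integral_sum => i _; apply: has_integral_sum => k _.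
  apply: has_integralB; first by apply: has_integralD; exact: Phi_int.
  rewrite mulrC; under eq_fun do rewrite mulrC; apply: has_integralZ.
  by apply: has_integralD; apply: Phi_int; exact: bdd_linear_add.
(* The index types are finite, so one null set serves all indices. *)
have H1 : \forall x \ae mu, forall i, Phi (f i) x = \sum_j c i j * Phi (h j) x.
  by apply: filter_forall => i; have := Phisum (index_enum J) i; rewrite -fh.
have H2 : \forall x \ae mu, forall i k, Phi (f i + f k) x = Phi (f i) x + Phi (f k) x.
  by apply: filter_forall => i; apply: filter_forall => k; exact: PhiD.
have H3 : \forall x \ae mu, forall i k, Phi (f i - f k) x = Phi (f i) x - Phi (f k) x.
  apply: filter_forall => i; apply: filter_forall => k.
  apply: filterS2 (PhiD _ _ (bf i) (bNf k)) (PhiZ (-1) _ (bf k)) => x ->.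
  by rewrite scaleN1r mulN1r => ->.
apply: filterS3 H1 H2 H3 => x H1 H2 H3; rewrite subr_ge0.
under [X in _ + X]eq_bigr do under eq_bigr do rewrite H2 H3.
apply: sum_norm_le_max => [|i]; first exact: sumr_ge0.
rewrite H1 (le_trans (ler_norm_sum _ _ _))//; apply: ler_sum => j _.
by rewrite normrM ler_piMl.
Qed.

End L1Disjointness.

(** * Signed sums and the lifting of almost disjoint functionals *)

Section SignedSums.
Variables (R : realType) (X : normedModType R) (I : finType).
Local Notation S := {ffun I -> bool}.

(** Sign vectors are the extreme points of the cube, so the largest norm of a signed sum is the norm
    of the operator from the sup-normed space on [I] to [X] that sends the unit vectors to the
    [e i]. *)
Definition signed_sums (e : I -> X) : S -> X :=
  fun s => \sum_i (-1) ^+ s i *: e i.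

Lemma signed_sumsD a e e' :
  signed_sums (fun i => a *: e i + e' i) = a *: signed_sums e + signed_sums e'.
Proof.
apply/funext => s; rewrite !fctE /signed_sums scaler_sumr -big_split/=.
by apply: eq_bigr => i _; rewrite scalerDr !scalerA mulrC.
Qed.

Definition supnorm (v : S -> X) : R := \big[Num.max/0]_s `|v s|.

Lemma supnorm_ge0 v : 0 <= supnorm v. Proof. exact: bigmax_ge_id. Qed.

Lemma le_supnorm v s : `|v s| <= supnorm v. Proof. exact: le_bigmax. Qed.

Lemma supnorm_le v K : 0 <= K -> (forall s, `|v s| <= K) -> supnorm v <= K.
Proof. by move=> K0 vK; exact: bigmax_le. Qed.

Lemma sublinear_supnorm M : 0 <= M -> sublinear (fun v => M * supnorm v).
Proof.
move=> M0; split=> [v w|a v a0].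
  rewrite -mulrDr ler_wpM2l// supnorm_le ?addr_ge0 ?supnorm_ge0// => s.
  by rewrite fctE (le_trans (ler_normD _ _))// lerD// le_supnorm.
rewrite mulrCA ler_wpM2l// supnorm_le ?mulr_ge0 ?supnorm_ge0// => s.
by rewrite fctE normrZ ger0_norm// ler_wpM2l// le_supnorm.
Qed.

(* [f] defines a functional on the range of [signed_sums] inside the sup-normed
   power of [X] indexed by sign vectors; [h s] is the [s]-th coordinate of a
   norm-preserving extension. *)
Lemma signed_extension (f : I -> X -> R^o) M : (forall i, bdd_linear (f i)) ->
  (forall e, (forall s, `|signed_sums e s| <= 1) -> \sum_i f i (e i) <= M) ->
  exists h : S -> X -> R^o, [/\ forall s, bdd_linear (h s),
    forall i, f i = \sum_(s : S) ((-1) ^+ s i : R) *: h s & \sum_s opnorm (h s) <= M].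
Proof.
move=> bf fM.
have M0 : 0 <= M.
  have := fM (fun=> 0); rewrite big1 => [|i _]; last exact: bdd_linear0.
  by apply=> s; rewrite /signed_sums big1 ?normr0// => i _; rewrite scaler0.
have fK e K : 0 < K -> (forall s, `|signed_sums e s| <= K) ->
    \sum_i f i (e i) <= M * K.
  move=> K0 eK; rewrite -ler_pdivrMr// mulrC mulr_sumr.
  have e0 : signed_sums (fun i => K^-1 *: e i) = K^-1 *: signed_sums e.
    apply/funext => s; rewrite fctE /signed_sums scaler_sumr.
    by apply: eq_bigr => i _; rewrite !scalerA mulrC.
  rewrite (le_trans _ (fM (fun i => K^-1 *: e i) _))//.
    by apply: ler_sum => i _; rewrite (bdd_linearZ _ _ (bf i)).
  move=> s; rewrite e0 fctE normrZ gtr0_norm ?invr_gt0// mulrC.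
  by rewrite ler_pdivrMr// mul1r.
(* The constraints form a linear subspace, so [g] satisfies them with equality; below this is
   obtained by comparing [x] with [- x]. *)
have [||g [lg gM gC]] := @mazur_orlicz R (S -> X : lmodType R) (fun v => M * supnorm v)
    [set u | exists e, u = (signed_sums e, \sum_i f i (e i))].
- exact: sublinear_supnorm.
- have C2 a e e' : \sum_i f i (a *: e i + e' i) =
      a * \sum_i f i (e i) + \sum_i f i (e' i).
    by rewrite mulr_sumr -big_split; apply: eq_bigr => i _; rewrite (bf i).1.
  have C0 : (0 : S -> X, 0 : R) = (signed_sums (fun=> 0), \sum_i f i ((fun=> 0) i)).
    congr (_, _); last by rewrite big1// => i _; exact: bdd_linear0.
    by apply/funext => s; rewrite /signed_sums big1// => i _; rewrite scaler0.
  split=> [|v b w c [e [-> ->]] [e' [-> ->]]|a v b a0 [e [-> ->]]|v b [e [-> ->]]].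
  + by exists (fun=> 0).
  + exists (fun i => 1 *: e i + e' i).
    by rewrite signed_sumsD C2 scale1r mul1r.
  + exists (fun i => a *: e i + 0).
    rewrite (signed_sumsD _ _ (fun=> 0)) (C2 _ _ (fun=> 0)).
    by case: C0 => <- <-; rewrite !addr0.
  (* [supnorm] may vanish, so [fK] is used at a slightly larger positive bound; [del] keeps the
     excess [M * del] below [eps]. *)
  + apply/ler_addgt0Pr => eps eps0.
    pose del := eps / (M + 1); have del0 : 0 < del by rewrite divr_gt0// ltr_wpDl.
    rewrite (le_trans (fK e (supnorm (signed_sums e) + del) _ _))//.
    * by rewrite ltr_wpDl// supnorm_ge0.
    * by move=> s; rewrite (le_trans (le_supnorm _ s))// lerDl ltW.
    * rewrite mulrDr lerD2l /del mulrCA ger_pMr// ler_pdivrMr ?ltr_wpDl//.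
      by rewrite mul1r lerDl.
pose delta (s : S) (x : X) : S -> X := fun t => if t == s then x else 0.
have delta_sum (v : S -> X) : v = \sum_s delta s (v s).
  apply/funext => t; rewrite fct_sumE (bigD1 t)//= /delta eqxx big1 ?addr0// => s.
  by rewrite eq_sym => /negbTE ->.
pose h (s : S) : X -> R^o := fun x => g (delta s x).
have bh s : bdd_linear (h s).
  apply: (@linear_form_bdd _ _ (h s) M) => [a x y|x].
    rewrite /h -lg; congr g; apply/funext => t; rewrite !fctE /delta.
    by case: ifP => //; rewrite scaler0 addr0.
  rewrite (le_trans (gM _))// ler_wpM2l// supnorm_le// => t.
  by rewrite /delta; case: ifP; rewrite ?normr0.
exists h; split => // [i|].
  apply/funext => x; rewrite fct_sumE.
  pose e y : I -> X := fun k => if k == i then y else 0.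
  have fe y : \sum_k f k (e y k) = f i y.
    rewrite (bigD1 i)//= /e eqxx big1 ?addr0// => k /negbTE ->.
    exact: bdd_linear0.
  have ge y : g (signed_sums (e y)) = \sum_(s : S) (-1) ^+ s i * h s y.
    rewrite [in LHS](delta_sum (signed_sums (e y))) linear_form_sum//.
    apply: eq_bigr => s _; rewrite /h -linear_formZ//; congr g.
    apply/funext => t; rewrite fctE /delta; case: ifP; rewrite ?scaler0// => _.
    rewrite /signed_sums (bigD1 i)//= /e eqxx big1 ?addr0// => k /negbTE ->.
    by rewrite scaler0.
  have ub y : f i y <= g (signed_sums (e y)) by apply: gC; exists (e y); rewrite fe.
  rewrite -[RHS]/(\sum_(s : S) (-1) ^+ s i * h s x) -ge; apply/le_anti.
  rewrite ub/=; have := ub (- x); rewrite -scaleN1r (bdd_linearZ _ _ (bf i)).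
  suff -> : g (signed_sums (e (-1 *: x))) = - g (signed_sums (e x)).
    by rewrite scaleN1r lerN2.
  rewrite !ge -sumrN; apply: eq_bigr => s _.
  by rewrite (bdd_linearZ _ _ (bh s)) scaleN1r mulrN.
apply/ler_addgt0Pr => eps eps0; pose N : R := #|S|%:R.
have N0 : 0 < N + 1 by rewrite ltr_wpDl.
(* The vectors [x s] almost norm the [h s], with sign adjusted. Together they form one point of the
   sup-norm unit ball, so the sum of the [h s (x s)] is [g x <= M]. *)
have /choice[x xP] s : exists x : X, `|x| <= 1 /\ opnorm (h s) - eps / (N + 1) <= h s x.
  have [x x1 hx] := opnorm_approx (bh s) (divr_gt0 eps0 N0).
  have [h0|h0] := leP 0 (h s x).
    by exists x; split; rewrite // (le_trans (ltW hx))// ger0_norm.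
  exists (- x); rewrite normrN; split => //.
  rewrite (le_trans (ltW hx))// ltr0_norm//.
  by rewrite -[in leRHS]scaleN1r (bdd_linearZ _ _ (bh s)) scaleN1r.
have : \sum_s (opnorm (h s) - eps / (N + 1)) <= M.
  rewrite (le_trans (ler_sum _ (fun s _ => (xP s).2)))//.
  rewrite (_ : \sum_s _ = g x); last by rewrite [in RHS](delta_sum x) linear_form_sum.
  rewrite (le_trans (gM _))// ler_piMr// supnorm_le// => s; exact: (xP s).1.
rewrite sumrB sumr_const -[X in _ - X]mulr_natr -/N lerBlDr => /le_trans; apply.
by rewrite lerD2l -mulrA ger_pMr// mulrC ler_pdivrMr// mul1r lerDl.
Qed.

(** Otherwise [signed_extension] writes the [f i] as signed sums of functionals of total norm at
    most [n - (n + n^2 + 1) * d]. By [L1_predual_norm_sum] the norms of the [f i] then sum to at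
    most [n - (n + 1) * d], whereas they sum to at least [n - n * d]. *)
Lemma almost_disjoint_lift (f : I -> X -> R^o) (d : R) : L1_predual X ->
  (forall i, bdd_linear (f i)) -> 0 < d ->
  (forall i, 1 - d <= opnorm (f i) <= 1) ->
  (forall i k, k != i -> 2 - d <= opnorm (f i + f k)) ->
  (forall i k, k != i -> 2 - d <= opnorm (f i - f k)) ->
  exists e : I -> X, (forall s, `|signed_sums e s| <= 1) /\
    #|I|%:R - (#|I|%:R + #|I|%:R ^+ 2 + 1) * d <= \sum_i f i (e i).
Proof.
move=> L1X bf d0 f1 fD fB; set n : R := #|I|%:R.
apply/not_existsP => noe.
have fM e : (forall s, `|signed_sums e s| <= 1) ->
    \sum_i f i (e i) <= n - (n + n ^+ 2 + 1) * d.
  by move=> e1; rewrite leNgt; apply/negP => /ltW lt; apply: (noe e).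
have [h [bh fh hM]] := signed_extension bf fM.
have := L1_predual_norm_sum L1X bf bh _ fh.
have c1 i s : `|(-1) ^+ (s : S) i : R| <= 1 by rewrite normr_sign.
move=> /(_ c1); apply/negP; rewrite -ltNge.
have lb : n * (1 - d) <= \sum_i opnorm (f i).
  rewrite -[n]mulr1 -/n -mulrA mul1r mulr_natl -sumr_const.
  by apply: ler_sum => i _; have /andP[] := f1 i.
(* Each pair contributes at most [1 + 1 - (2 - d) = d]. *)
have ub : \sum_i \sum_(k | k != i) (opnorm (f i) + opnorm (f k)
     - (opnorm (f i + f k) + opnorm (f i - f k)) / 2) <= n * (n * d).
  rewrite !mulr_natl -sumr_const; apply: ler_sum => i _.
  rewrite (@le_trans _ _ (\sum_(k : I | k != i) d))//.
    apply: ler_sum => k ki; have := fD _ _ ki; have := fB _ _ ki.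
    by have /andP[_] := f1 i; have /andP[_] := f1 k; lra.
  by rewrite -sumr_const [leRHS](bigD1 i)//= ler_wpDl// ltW.
move: lb ub hM; set a := \sum_i _; set b := \sum_i _; set c := \sum_s _.
by rewrite expr2; nra.
Qed.

End SignedSums.

(** * Octahedral spaces: directions and separated functionals *)

Section Octahedral.
Variables (R : realType) (X : normedModType R).

Lemma mem_span_seq (V : lmodType R) (s : seq V) x : x \in s -> span_seq s x.
Proof.
move=> xs; have ix : (index x s < size s)%N by rewrite index_mem.
exists (fun i => (i == Ordinal ix)%:R).
rewrite (bigD1 (Ordinal ix))//= eqxx scale1r nth_index// big1 ?addr0// => i /negbTE ->.
by rewrite scale0r.
Qed.

(** The relative error [d / (K + 1)], with [K] bounding the norms in [s], turns into an additive
    error [d]. *)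
Lemma octahedral_point (s : seq X) (d : R) : octahedral X -> 0 < d ->
  exists2 u : X, `|u| = 1 &
    forall x (b : bool), x \in s -> `|x| + 1 - d <= `|x + (-1) ^+ b *: u|.
Proof.
move=> oX d0; pose K := \sum_(x <- s) `|x|.
have xK x : x \in s -> `|x| <= K.
  move=> xs; rewrite /K (perm_big _ (perm_to_rem xs))/= big_cons lerDl.
  by rewrite sumr_ge0.
have K0 : 0 < K + 1 by rewrite ltr_wpDl// sumr_ge0.
have [//|u [_ [u1 us]]] := oX s _ (d / (K + 1)) (divr_gt0 d0 K0).
exists u => // x b xs; have := us x (mem_span_seq xs) ((-1) ^+ b).
rewrite normr_sign; apply: le_trans.
rewrite mulrBl mul1r lerD2l lerN2 -mulrA ger_pMr// mulrC ler_pdivrMr//.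
by rewrite mul1r lerD2r xK.
Qed.

(** By induction: the remaining directions are chosen for all the points [x + u0] and [x - u0], with
    half of the error left. *)
Lemma octahedral_points (m : nat) (s : seq X) (d : R) : octahedral X -> 0 < d ->
  exists2 u : 'I_m -> X, (forall i, `|u i| = 1) &
    forall x (b : 'I_m -> bool), x \in s ->
      `|x| + m%:R - d <= `|x + \sum_i (-1) ^+ b i *: u i|.
Proof.
move=> oX; elim: m s d => [|m ih] s d d0.
  exists (fun=> 0) => [[]//|x b _].
  by rewrite big_ord0 !addr0 gerBl ltW.
have d20 : 0 < d / 2 by rewrite divr_gt0.
have [u0 u01 u0s] := octahedral_point s oX d20.
have [u u1 us] := ih (map (fun x => x + (-1) ^+ false *: u0) s
                      ++ map (fun x => x + (-1) ^+ true *: u0) s) _ d20.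
exists (fun i => oapp u u0 (unlift ord0 i)) => [i|x b xs].
  by case: (unlift ord0 i) => [j|] /=.
rewrite big_ord_recl unlift_none/= addrA.
under eq_bigr do rewrite liftK/=.
have xs' : x + (-1) ^+ b ord0 *: u0 \in
    map (fun x => x + (-1) ^+ false *: u0) s ++ map (fun x => x + (-1) ^+ true *: u0) s.
  by rewrite mem_cat; case: (b ord0); apply/orP; [right|left]; apply/mapP; exists x.
have := us _ (fun i => b (lift ord0 i)) xs'; have := u0s _ (b ord0) xs.
by rewrite -[in m.+1%:R]addn1 natrD; lra.
Qed.

(** The deficits [1 - t i] are nonnegative and sum to at most [d]. *)
Lemma term_ge_of_sum_ge (I : finType) (t : I -> R) (d : R) :
  (forall i, t i <= 1) -> #|I|%:R - d <= \sum_i t i -> forall i, 1 - d <= t i.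
Proof.
move=> t1 st i; have : 1 - t i <= \sum_j (1 - t j).
  by rewrite [leRHS](bigD1 i)//= lerDl sumr_ge0// => j _; rewrite subr_ge0.
by rewrite sumrB sumr_const; lra.
Qed.

(** [f k] norms [z k] plus a signed sum of the [u i]; that norm is almost maximal, so every summand
    is almost normed. A direction with common sign separates [f k] from [- f l], one with opposite
    signs separates [f k] from [f l]. *)
Lemma octahedral_functionals (n : nat) (z : 'I_n -> X) (d : R) :
  octahedral X -> 0 < d ->
  exists f : 'I_n -> X -> R^o, [/\ forall k, bdd_linear (f k),
    forall k x, `|f k x| <= `|x|, forall k, `|z k| - d <= f k (z k),
    forall k, 1 - d <= opnorm (f k) &
    forall k l, l != k ->
      2 - d <= opnorm (f k + f l) /\ 2 - d <= opnorm (f k - f l)].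
Proof.
move=> oX d0; have d20 : 0 < d / 2 by rewrite divr_gt0.
have [u u1 us] := octahedral_points n.+1 (codom z) oX d20.
(* All sign patterns agree at [ord0]; only the [k]-th one is [+] at [k + 1]. *)
pose b (k : 'I_n) (i : 'I_n.+1) := oapp (fun l => l != k) false (unlift ord0 i).
pose w k := z k + \sum_i (-1) ^+ b k i *: u i.
have /choice[f fP] k := norming_functional (w k).
have bf k : bdd_linear (f k) by have [] := fP k.
have f1 k x : `|f k x| <= `|x| by have [_ + _] := fP k; apply.
have fw k : f k (z k) + \sum_i (-1) ^+ b k i * f k (u i) >= `|z k| + n.+1%:R - d / 2.
  have [_ _] := fP k.
  rewrite (bdd_linearD _ _ (bf k)) (bdd_linear_sum _ _ _ (bf k)) => fkw.
  under eq_bigr do rewrite -[_ * _]/((-1) ^+ _ *: (_ : R^o)) -(bdd_linearZ _ _ (bf k)).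
  by rewrite fkw us// codom_f.
have le1 k i : (-1) ^+ b k i * f k (u i) <= 1.
  by rewrite (le_trans (ler_norm _))// normrM normr_sign mul1r (le_trans (f1 _ _))// u1.
have fu k i : 1 - d / 2 <= (-1) ^+ b k i * f k (u i).
  apply: (term_ge_of_sum_ge (t := fun i => (-1) ^+ b k i * f k (u i))) => //.
  rewrite card_ord.
  by have := fw k; have := le_trans (ler_norm _) (f1 k (z k)); lra.
have fu0 k : 1 - d / 2 <= f k (u ord0).
  by have := fu k ord0; rewrite /b unlift_none mul1r.
have fuk k : 1 - d / 2 <= f k (u (lift ord0 k)).
  by have := fu k (lift ord0 k); rewrite /b liftK/= eqxx mul1r.
have ful k l : l != k -> f l (u (lift ord0 k)) <= - (1 - d / 2).
  by move=> lk; have := fu l (lift ord0 k); rewrite /b liftK/= eq_sym lk mulN1r; lra.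
have op g i r : @bdd_linear R X R^o g -> r <= g (u i) -> r <= opnorm g.
  move=> bg rg; have := le_opnorm (u i) bg; rewrite u1 mulr1; apply: le_trans.
  exact: le_trans rg (ler_norm _).
exists f; split => // [k|k|k l lk].
- have : \sum_i (-1) ^+ b k i * f k (u i) <= \sum_(i < n.+1) 1 by exact: ler_sum.
  by rewrite sumr_const card_ord; have := fw k; lra.
- by apply: (op _ ord0) => //; have := fu0 k; lra.
- split.
    apply: (op _ ord0); first exact: bdd_linear_add.
    by rewrite fctE; have := fu0 k; have := fu0 l; lra.
  apply: (op _ (lift ord0 k)).
    by rewrite -scaleN1r; apply: bdd_linear_add => //; exact: bdd_linear_scale.
  by rewrite fctE; have := fuk k; have := ful _ _ lk; rewrite fctE; lra.
Qed.

End Octahedral.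

(** * A contraction almost additive at finitely many vectors *)

Section OperatorNearPoints.
Variables (R : realType) (Y X : normedModType R).

(** With the signs of the [g (e i)], the sum is the value of [g] at one signed sum. *)
Lemma signed_sums_functional (I : finType) (e : I -> X) (g : X -> R^o) :
  (forall s, `|signed_sums e s| <= 1) -> bdd_linear g ->
  (forall x, `|g x| <= `|x|) -> \sum_i `|g (e i)| <= 1.
Proof.
move=> e1 bg g1; pose s : {ffun I -> bool} := [ffun i => g (e i) < 0].
apply: le_trans (e1 s); apply: le_trans (g1 _); apply: le_trans (ler_norm _).
rewrite (bdd_linear_sum _ _ _ bg); apply: ler_sum => i _.
rewrite (bdd_linearZ _ _ bg) ffunE -[_ *: _]/((-1) ^+ _ * g (e i)).
by case: (ger0P (g (e i))) => _; rewrite ?mul1r ?mulN1r.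
Qed.

Lemma octahedral_operator (n : nat) (z : 'I_n -> X) (y : 'I_n -> Y) (d : R) :
  L1_predual X -> octahedral X -> (forall k, `|y k| = 1) -> 0 < d ->
  exists S : Y -> X, [/\ bdd_linear S, forall v, `|S v| <= `|v| &
    forall k lam, 0 <= lam ->
      `|z k| + lam - d * (1 + lam) <= `|z k + lam *: S (y k)|].
Proof.
move=> L1X oX y1 d0.
(* [C] is the loss factor of [almost_disjoint_lift]; run at [d / (2 * C)], it loses only [d / 2]. *)
pose C : R := n%:R + n%:R ^+ 2 + 1.
have C1 : 1 <= C by rewrite lerDr addr_ge0// sqr_ge0.
have d10 : 0 < d / (2 * C) by rewrite divr_gt0// mulr_gt0// (lt_le_trans ltr01).
have [f [bf f1 fz fn fd]] := octahedral_functionals z oX d10.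
have [|||e [e1 fe]] := @almost_disjoint_lift R X _ f _ L1X bf d10.
- move=> k; rewrite fn/=; apply: opnorm_le => x x1; exact: le_trans (f1 k x) x1.
- by move=> k l lk; case: (fd _ _ lk).
- by move=> k l lk; case: (fd _ _ lk).
rewrite card_ord -/C in fe.
have Cd : C * (d / (2 * C)) = d / 2 by field; lra.
rewrite Cd in fe.
have /choice[phi phiP] k := norming_functional (y k).
have bphi k : bdd_linear (phi k) by have [] := phiP k.
have phi1 k v : `|phi k v| <= `|v| by have [_ + _] := phiP k; apply.
have phiy k : phi k (y k) = 1 by have [_ _ ->] := phiP k.
have fe1 k : \sum_i `|f k (e i)| <= 1 by exact: signed_sums_functional.
have fee k : 1 - d / 2 <= f k (e k).
  apply: (term_ge_of_sum_ge (t := fun k => f k (e k))); last by rewrite card_ord.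
  move=> i; rewrite (le_trans (ler_norm _))// (le_trans _ (fe1 i))//.
  by rewrite [leRHS](bigD1 i)//= lerDl sumr_ge0.
pose S (v : Y) : X := \sum_i (phi i v : R) *: e i.
(* For [g] norming [S v], the factors [phi i v] are at most the norm of [v] and the [g (e i)] have
   absolute sum at most 1. *)
have S1 v : `|S v| <= `|v|.
  have [g [bg g1 gS]] := norming_functional (S v).
  rewrite -gS (bdd_linear_sum _ _ _ bg).
  have := signed_sums_functional e1 bg g1 => /(ler_wpM2l (normr_ge0 v)).
  rewrite mulr1; apply: le_trans; rewrite mulr_sumr; apply: ler_sum => i _.
  rewrite (le_trans (ler_norm _))// (bdd_linearZ _ _ bg) normrZ.
  by rewrite ler_wpM2r.
have bS : bdd_linear S.
  split; last by exists 1 => v; rewrite mul1r.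
  move=> a v w; rewrite /S scaler_sumr -big_split; apply: eq_bigr => i _.
  by rewrite (bphi i).1 scalerDl scalerA.
exists S; split => // k lam lam0.
(* The diagonal term is at least [1 - d / 2], which by [fe1] leaves at most [d / 2] for all the
   others. *)
have fS : 1 - d <= f k (S (y k)).
  rewrite (bdd_linear_sum _ _ _ (bf k)) (bigD1 k)//= phiy scale1r.
  have : - \sum_(i | i != k) `|f k (e i)|
      <= \sum_(i | i != k) f k ((phi i (y k) : R) *: e i).
    rewrite -sumrN; apply: ler_sum => i _.
    rewrite (bdd_linearZ _ _ (bf k)) lerNl (le_trans (ler_norm _))// normrN.
    rewrite normrZ ler_piMl//.
    by rewrite (le_trans (phi1 _ _))// y1.
  have := fe1 k; rewrite (bigD1 k)//=; have := fee k.
  have := ler_norm (f k (e k)).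
  set a := \sum_(i | _) _; set b := \sum_(i | _) _ => *; lra.
have := le_trans (ler_norm _) (f1 k (z k + lam *: S (y k))).
rewrite (bdd_linearD _ _ (bf k)) (bdd_linearZ _ _ (bf k)); apply: le_trans.
have dC : d / (2 * C) <= d.
  by rewrite ler_pdivrMr ?ler_peMr ?(ltW d0)//; lra.
have := fz k; have := ler_wpM2l lam0 fS.
rewrite -[lam *: f k _]/(lam * f k _); lra.
Qed.

End OperatorNearPoints.

(** * Finite nets in finitely generated spans *)

Lemma span_seqZ (R : realType) (V : lmodType R) (s : seq V) a x :
  span_seq s x -> span_seq s (a *: x).
Proof.
move=> [c ->]; exists (fun i => a * c i); rewrite scaler_sumr.
by apply: eq_bigr => i _; rewrite scalerA.
Qed.

Section TotalBoundedness.
Variables (R : realType) (V : lmodType R) (W : set V) (p : V -> R).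
Hypothesis W0 : W 0.
Hypothesis Wlin : forall a x y, W x -> W y -> W (a *: x + y).
Hypothesis p_ge0 : forall x, W x -> 0 <= p x.
Hypothesis pD : forall x y, W x -> W y -> p (x + y) <= p x + p y.
Hypothesis pZ : forall a x, W x -> p (a *: x) = `|a| * p x.

Let WZ a x : W x -> W (a *: x).
Proof. by move=> Wx; rewrite -[a *: x]addr0; exact: Wlin. Qed.

Let WD x y : W x -> W y -> W (x + y).
Proof. by move=> Wx; rewrite -[x]scale1r; exact: Wlin. Qed.

Let WB x y : W x -> W y -> W (x - y).
Proof. by move=> Wx Wy; apply: WD => //; rewrite -scaleN1r; exact: WZ. Qed.

Lemma span_seq_cons v (s : seq V) x :
  span_seq (v :: s) x <-> exists t u, span_seq s u /\ x = u + t *: v.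
Proof.
split=> [[c ->]|[t [_ [[c ->] ->]]]].
  exists (c ord0), (\sum_(i < size s) c (lift ord0 i) *: s`_i).
  by split; [exists (fun i => c (lift ord0 i))|rewrite big_ord_recl addrC].
exists (fun i : 'I_(size s).+1 => oapp c t (unlift ord0 i)).
rewrite big_ord_recl unlift_none addrC; congr (_ + _).
by apply: eq_bigr => i _; rewrite liftK.
Qed.

Lemma span_seq_sub (s : seq V) x : (forall v, v \in s -> W v) -> span_seq s x -> W x.
Proof.
move=> sW [c ->]; apply: (big_ind W) => // i _.
by apply/WZ/sW/mem_nth.
Qed.

(** A grid of mesh [eta] starting at [- K]; [t] is rounded down. *)
Lemma finite_net_interval (K eta : R) : 0 < eta ->
  exists r : seq R, forall t, `|t| <= K -> exists2 t', t' \in r & `|t - t'| <= eta.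
Proof.
move=> eta0; pose N := (Num.truncn ((K + K) / eta)).+1.
exists [seq eta * k%:R - K | k <- iota 0 N] => t; rewrite ler_norml => /andP[tl tr].
pose k := Num.truncn ((t + K) / eta).
have q0 : 0 <= (t + K) / eta by rewrite divr_ge0 ?(ltW eta0)//; lra.
have /andP[kl kr] := truncn_itv q0.
exists (eta * k%:R - K).
  apply/mapP; exists k; rewrite // mem_iota/= add0n ltnS; apply: le_truncn.
  by rewrite ler_pM2r ?invr_gt0//; lra.
rewrite ler_pdivlMr// mulrC -/k in kl.
rewrite ltr_pdivrMr// mulrC -/k -natr1 mulrDr in kr.
by rewrite ler_norml; apply/andP; split; lra.
Qed.

(** Induction on the generators, which may be dependent. If [v] has distance at least [e > 0] from
    the span of [s], the coefficient of [v] in [x] is at most [p x / e] in absolute value and nets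
    for coefficient and remainder combine; at distance 0 a net for [s] suffices. *)
Lemma span_seq_net (s : seq V) : (forall v, v \in s -> W v) ->
  forall K d : R, 0 < d -> exists r : seq V, (forall x, x \in r -> span_seq s x) /\
    forall x, span_seq s x -> p x <= K -> exists2 x', x' \in r & p (x - x') <= d.
Proof.
elim: s => [|v s ih] sW K d d0.
  have p0 : p 0 = 0 by rewrite -(scale0r 0) pZ// normr0 mul0r.
  have span0 (x : V) : span_seq [::] x -> x = 0 by move=> [c ->]; rewrite big_ord0.
  exists [:: 0]; split=> [x|x /span0 -> _].
    by rewrite inE => /eqP ->; exists (fun=> 0); rewrite big_ord0.
  by exists 0; rewrite ?inE// subr0 p0 ltW.
have Wv : W v by apply: sW; rewrite inE eqxx.
have sW' w : w \in s -> W w by move=> ws; apply: sW; rewrite inE ws orbT.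
have sub x : span_seq s x -> W x by exact: span_seq_sub.
have d20 : 0 < d / 2 by rewrite divr_gt0.
have [[e e0 dist]|nodist] :=
    pselect (exists2 e, 0 < e & forall u, span_seq s u -> e <= p (v + u)).
- have pv := p_ge0 Wv.
  have p1 : 0 < p v + 1 by lra.
  (* This mesh makes the rounding of the coefficient cost at most [d / 2]; the radius used for [ru]
     bounds [p (x - t *: v)]. *)
  have [rt rtP] := finite_net_interval (K / e) (divr_gt0 d20 p1).
  have [ru [rus ruP]] := ih sW' (K + K / e * p v) _ d20.
  exists [seq u + t *: v | u <- ru, t <- rt]; split.
    by move=> _ /allpairsP[[u t] [/= /rus su _ ->]]; apply/span_seq_cons; exists t, u.
  move=> x /span_seq_cons[t [u [su ->]]] xK; have Wu := sub _ su.
  have tK : `|t| <= K / e.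
    rewrite ler_pdivlMr//; have [->|t0] := eqVneq t 0.
      rewrite normr0 mul0r; apply: le_trans xK; apply: p_ge0.
      by apply: WD => //; exact: WZ.
    apply: le_trans xK; rewrite -[u + _]scale1r -(mulfV t0) -scalerA pZ; last first.
      by apply/WZ/WD => //; exact: WZ.
    rewrite ler_wpM2l// scalerDr scalerA mulVf// scale1r addrC dist//.
    exact: span_seqZ.
  have [t' t'r tt'] := rtP _ tK.
  have uK : p u <= K + K / e * p v.
    rewrite -[u](addrK (t *: v)) -scaleNr (le_trans (pD _ _))//.
    - by apply: WD => //; exact: WZ.
    - exact: WZ.
    - by rewrite pZ// normrN lerD// ler_wpM2r.
  have [u' u'r uu'] := ruP _ su uK.
  exists (u' + t' *: v); first by apply/allpairsP; exists (u', t').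
  rewrite opprD addrACA -scalerBl (le_trans (pD _ _))//.
  + by apply: WB => //; exact: sub (rus _ u'r).
  + exact: WZ.
  + rewrite [leRHS](splitr d) lerD// pZ//.
    rewrite (le_trans (ler_wpM2r pv tt'))// -mulrA ler_piMr ?(ltW d20)//.
    by rewrite mulrC ler_pdivrMr// mul1r lerDl.
(* Here [v] is in the [p]-closure of the span of [s]. *)
- have [r [rs rP]] := ih sW' (K + d / 2) _ d20.
  exists r; split=> [x /rs sx|x /span_seq_cons[t [u [su ->]]] xK].
    by apply/span_seq_cons; exists 0, x; rewrite scale0r addr0.
  have Wu := sub _ su; have t10 : 0 < `|t| + 1 by rewrite ltr_wpDl.
  (* [u0] may depend on [t], as the net is already fixed: [x] is within [d / 2] of [u - t *: u0],
     which lies in the span of [s]. *)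
  have [u0 su0 vu0] : exists2 u0, span_seq s u0 & p (v + u0) < d / 2 / (`|t| + 1).
    apply: contrapT => H; apply: nodist; exists (d / 2 / (`|t| + 1)) => [|u1 su1].
      by rewrite divr_gt0.
    by rewrite leNgt; apply/negP => lt; apply: H; exists u1.
  have Wu0 := sub _ su0; have Wvu0 := WD Wv Wu0.
  have ptvu : p (t *: (v + u0)) <= d / 2.
    rewrite pZ//; move: vu0; rewrite ltr_pdivlMr// => vu0.
    by have := p_ge0 Wvu0; nra.
  have sx' : span_seq s (u - t *: u0).
    case: su su0 => c -> [c0 ->]; exists (fun i => c i - t * c0 i).
    rewrite scaler_sumr -sumrB; apply: eq_bigr => i _.
    by rewrite scalerBl scalerA.
  have Wx' := sub _ sx'; have Wx : W (u + t *: v) by apply: WD => //; exact: WZ.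
  have x'E : u - t *: u0 = (u + t *: v) - t *: (v + u0).
    by rewrite scalerDr opprD addrA addrK.
  have [|x'' x''r xx''] := rP _ sx'.
    rewrite x'E -scaleNr (le_trans (pD _ _))//; first exact: WZ.
    by rewrite pZ// normrN -pZ// lerD.
  exists x'' => //; have Wx'' := sub _ (rs _ x''r).
  rewrite (_ : _ - _ = (u - t *: u0 - x'') + t *: (v + u0)); last first.
    by rewrite x'E [RHS]addrAC subrK.
  rewrite (le_trans (pD _ _))//; [exact: WB|exact: WZ|].
  by rewrite [leRHS](splitr d) lerD.
Qed.

End TotalBoundedness.

(** * Octahedrality of the operator space *)

Lemma opnorm_unit_approx (R : realType) (Y X : normedModType R) (T : Y -> X) (d : R) :
  (exists y : Y, y != 0) -> bdd_linear T -> 0 < d ->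
  exists2 y : Y, `|y| = 1 & opnorm T - d <= `|T y|.
Proof.
move=> [y0 y00] bT d0.
have unit (y : Y) : y != 0 -> `| `|y|^-1 *: y| = 1.
  by move=> yn0; rewrite normrZ normfV normr_id mulVf// normr_eq0.
have [y y1 Ty] := opnorm_approx bT d0.
have [yE|yn0] := eqVneq y 0.
  (* Here [opnorm T < d], so any unit vector serves. *)
  exists (`|y0|^-1 *: y0); first exact: unit.
  by rewrite yE bdd_linear0// normr0 in Ty; rewrite (le_trans (ltW Ty)).
exists (`|y|^-1 *: y); first exact: unit.
rewrite (le_trans (ltW Ty))// bdd_linearZ// normrZ normfV normr_id.
by rewrite ler_peMl// invf_ge1// normr_gt0.
Qed.

Theorem theorem4p6 (R : realType) (X : completeNormedModType R) :
  L1_predual X -> octahedral X -> universally_octahedral X.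
Proof.
move=> L1X oX Y Yn0 s bs eps eps0.
(* The total relative loss will be [4 * d]; the bound [1 / 8] keeps [1 - 3 * d] and [1 - 4 * d]
   positive. *)
pose d : R := Num.min (eps / 4) (1 / 8).
have d0 : 0 < d by rewrite lt_min !divr_gt0.
have d4 : d <= eps / 4 by rewrite ge_min lexx.
have d8 : d <= 1 / 8 by rewrite ge_min lexx orbT.
have b0 := @bdd_linear_cst0 R Y X.
have blin a f g : bdd_ops f -> bdd_ops g -> @bdd_ops R Y X (a *: f + g).
  exact: bdd_linear_lin.
have [r [rs rnet]] := span_seq_net b0 blin (@opnorm_ge0 R Y X) (@opnormD R Y X)
  (@opnormZ R Y X) bs 1 d0.
have bspan T : span_seq s T -> bdd_linear T by exact: (span_seq_sub b0 blin bs).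
have /choice[yf yfP] (T : Y -> X) : exists y : Y,
    bdd_linear T -> `|y| = 1 /\ opnorm T - d <= `|T y|.
  have [bT|nbT] := pselect (bdd_linear T); last by exists 0.
  by have [y y1 Ty] := opnorm_unit_approx Yn0 bT d0; exists y.
(* The zero operator in the net makes [S] almost attain its norm. *)
pose r' := 0 :: r.
have br' (k : 'I_(size r')) : bdd_linear r'`_k.
  have : r'`_k \in r' by exact: mem_nth.
  by rewrite inE => /orP[/eqP ->//|/rs/bspan].
have yf1 (k : 'I_(size r')) : `|yf r'`_k| = 1 by case: (yfP _ (br' k)).
have [S [bS S1 Sr]] :=
  octahedral_operator (fun k : 'I_(size r') => r'`_k (yf r'`_k)) L1X oX yf1 d0.
have Sr_op T lam : T \in r' -> 0 <= lam ->
    opnorm T - d + lam - d * (1 + lam) <= opnorm (T + lam *: S).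
  move=> Tr lam0; have iT : (index T r' < size r')%N by rewrite index_mem.
  have := br' (Ordinal iT); have := Sr (Ordinal iT) _ lam0.
  rewrite /= nth_index// => SrT bT; have [y1 Ty] := yfP _ bT.
  have := le_opnorm (yf T) (bdd_linear_add bT (bdd_linear_scale lam bS)).
  by rewrite y1 mulr1 !fctE; lra.
pose q := opnorm S.
have q1 : q <= 1 by apply: opnorm_le => y y1; rewrite (le_trans (S1 y)).
have qd : 1 - 3 * d <= q.
  have := Sr_op 0 1; rewrite inE eqxx add0r scale1r => /(_ isT ler01).
  by have := opnorm_ge0 b0; rewrite -/q; lra.
have q0 : 0 < q by lra.
(* Passing to [T'] in the net and back costs [2 * d], besides the loss [d + d * (1 + lam)] of
   [Sr_op]. *)
have S_unit T lam : span_seq s T -> opnorm T <= 1 -> 0 <= lam ->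
    opnorm T + lam - 4 * d * (1 + lam) <= opnorm (T + lam *: S).
  move=> sT T1 lam0; have bT := bspan _ sT.
  have [T' T'r TT'] := rnet _ sT T1; have bT' := bspan _ (rs _ T'r).
  have bB f g : bdd_linear f -> bdd_linear g -> @bdd_linear R Y X (f - g).
    move=> bf bg; rewrite -scaleN1r; apply: bdd_linear_add => //.
    exact: bdd_linear_scale.
  have := Sr_op T' lam; rewrite inE T'r orbT => /(_ isT lam0).
  have := opnormD (bB _ _ bT bT') bT'; rewrite subrK.
  have := opnormD (bB _ _ bT' bT) (bdd_linear_add bT (bdd_linear_scale lam bS)).
  rewrite addrA subrK -opprB -scaleN1r opnormZ; last exact: bB.
  by rewrite normrN1 mul1r; nra.
(* By homogeneity this reduces to norm one; if [opnorm T = 0], the bound [qd] suffices. *)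
have S_pos T lam : span_seq s T -> 0 <= lam ->
    (1 - 4 * d) * (opnorm T + lam) <= opnorm (T + lam *: S).
  move=> sT lam0; have bT := bspan _ sT; have bSl := bdd_linear_scale lam bS.
  have := opnorm_ge0 bT; rewrite le0r => /orP[/eqP T0|T0].
    have bTS := bdd_linear_add bT bSl.
    have := opnormD bTS (bdd_linear_scale (-1) bT).
    rewrite scaleN1r addrAC subrr add0r -scaleN1r !opnormZ// T0 mulr0 addr0.
    by rewrite ger0_norm// -/q; nra.
  have := S_unit ((opnorm T)^-1 *: T) ((opnorm T)^-1 * lam).
  rewrite -scalerA -scalerDr !opnormZ//; last exact: bdd_linear_add.
  rewrite gtr0_norm ?invr_gt0// mulVf ?gt_eqF// lexx.
  move=> /(_ (span_seqZ _ sT) isT); rewrite mulr_ge0 ?invr_ge0 ?(ltW T0)//.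
  move=> /(_ isT); rewrite -(ler_pM2l T0) mulVKf ?gt_eqF//; apply: le_trans.
  by rewrite le_eqVlt; apply/orP; left; apply/eqP; field; rewrite gt_eqF.
have S_all T lam : span_seq s T ->
    (1 - 4 * d) * (opnorm T + `|lam|) <= opnorm (T + lam *: S).
  move=> sT; have bT := bspan _ sT; have [lam0|lam0] := ger0P lam; first exact: S_pos.
  have := S_pos ((-1) *: T) (- lam) (span_seqZ _ sT).
  rewrite oppr_ge0 (ltW lam0) => /(_ isT).
  rewrite -[- lam]mulN1r -scalerA -scalerDr !opnormZ ?normrN1 ?mul1r ?mulN1r//.
  by apply: bdd_linear_add => //; exact: bdd_linear_scale.
(* As [q <= 1], normalising [S] only enlarges the coefficient to which [S_all] is applied. *)
exists (q^-1 *: S); split; first exact: bdd_linear_scale.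
split; first by rewrite opnormZ// gtr0_norm ?invr_gt0// mulVf// gt_eqF.
move=> T sT lam; rewrite scalerA (le_trans _ (S_all _ _ sT))//.
have T0 := opnorm_ge0 (bspan _ sT).
rewrite normrM (gtr0_norm (_ : 0 < q^-1)) ?invr_gt0//.
have : `|lam| <= `|lam| / q by rewrite ler_peMr// invf_ge1.
have := normr_ge0 lam; set a := `|lam|; set b := a / q; set c := opnorm T in T0 *.
by move=> a0 ab; nra.
Qed.
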